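(* Let $J\colon\mathcal A\to\mathcal E$ be a pseudofunctor between bicategories, let $T$ be a $J$-relative pseudomonad, and let $(A,(-)^a,\hat a,\tilde a)$ and $(B,(-)^b,\hat b,\tilde b)$ be $T$-pseudoalgebras. For any adjunction $\ell\dashv r$ in $\mathcal E$ between their carriers, with $\ell\colon A\to B$ and $r\colon B\to A$, the following are in bijection: (1) colax morphism structures on $\ell$; (2) lax morphism structures on $r$.
   Context: Conventions. For a bicategory $\mathcal E$, $\mathcal E[X,Y]$ is the hom-category; composition of 1-cells and whiskering are written by juxtaposition, vertical composition of 2-cells by $\circ$; structural isomorphisms (associators, unitors, pseudofunctor constraints) are left implicit in equations or written $\cong$. A $J$-relative pseudomonad $T$ comprises: an object $TX\in\mathcal E$ for each $X\in\mathcal A$; functors $(-)^*\colon\mathcal E[JX,TY]\to\mathcal E[TX,TY]$ for $X,Y\in\mathcal A$; 1-cells $i_X\colon JX\to TX$; invertible 2-cells $\mu_{g,f}\colon(g^*f)^*\Rightarrow g^*f^*$ natural in $f\colon JX\to TY$, $g\colon JY\to TZ$; invertible 2-cells $\eta_f\colon f\Rightarrow f^*i_X$ natural in $f\colon JX\to TY$; invertible 2-cells $\theta_X\colon(i_X)^*\Rightarrow 1_{TX}$; such that $(\mu_{h,g}f^* )\circ\mu_{h^*g,f}=(h^*\mu_{g,f})\circ\mu_{h,g^*f}\circ(\mu_{h,g}f)^*$ for all $f\colon JW\to TX$, $g\colon JX\to TY$, $h\colon JY\to TZ$, and $(f^*\theta_X)\circ\mu_{f,i_X}\circ(\eta_f)^*$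 is the structural isomorphism $f^*\cong f^*1_{TX}$ for all $f\colon JX\to TY$. A $T$-pseudoalgebra $(A,(-)^a,\hat a,\tilde a)$ comprises: an object $A\in\mathcal E$ (the carrier); functors $(-)^a\colon\mathcal E[JX,A]\to\mathcal E[TX,A]$ for $X\in\mathcal A$; invertible 2-cells $\hat a_{g,f}\colon(g^af)^a\Rightarrow g^af^*$ natural in $f\colon JX\to TY$, $g\colon JY\to A$; invertible 2-cells $\tilde a_f\colon f\Rightarrow f^ai_X$ natural in $f\colon JX\to A$; such that $(\hat a_{h,g}f^* )\circ\hat a_{h^ag,f}=(h^a\mu_{g,f})\circ\hat a_{h,g^*f}\circ(\hat a_{h,g}f)^a$ for all $f\colon JX\to TY$, $g\colon JY\to TZ$, $h\colon JZ\to A$, and $(f^a\theta_X)\circ\hat a_{f,i_X}\circ(\tilde a_f)^a$ is the structural isomorphism $f^a\cong f^a1_{TX}$ for all $f\colon JX\to A$. A lax morphism structure on a 1-cell $h\colon A\to B$ between carriers of pseudoalgebras is a family of 2-cells $\overline h_f\colon(hf)^b\Rightarrow hf^a$ natural in $f\colon JX\to A$ such that $(h\hat a_{g,f})\circ\overline h_{g^af}\circ(\overline h_gf)^b=(\overline h_gf^* )\circ\hat b_{hg,f}$ for all $f\colon JX\to TY$, $g\colon JY\to A$, and $(\overline h_fi_X)\circ\tilde b_{hf}=h\tilde a_f$ for all $f\colon JX\to A$. A colax morphism structure is a family of 2-cells $\overline h_f\colon hf^a\Rightarrow(hf)^b$ natural in $f\colon JX\to A$ such that $\hat b_{hg,f}\circ(\overline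 h_gf)^b\circ\overline h_{g^af}=(\overline h_gf^* )\circ(h\hat a_{g,f})$ and $(\overline h_fi_X)\circ(h\tilde a_f)=\tilde b_{hf}$. *)

(* Defs.v *)
From Corelib Require Export ssreflect ssrfun.

Set Implicit Arguments.
Unset Strict Implicit.
Unset Printing Implicit Defensive.

Declare Scope bicat_scope.
Delimit Scope bicat_scope with bicat.
Open Scope bicat_scope.

Reserved Notation "x ⟹ y" (at level 70, no associativity).
Reserved Notation "x ≅ y" (at level 70, no associativity).
Reserved Notation "β ∘ α" (at level 50, left associativity).
Reserved Notation "g · f" (at level 40, left associativity).
Reserved Notation "g ◁ α" (at level 40, no associativity).
Reserved Notation "β ▷ f" (at level 40, no associativity).

(** * Categories and functors *)

Record category := Category {
  ob :> Type;
  mor : ob -> ob -> Type;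
  idm : forall x, mor x x;
  compm : forall x y z, mor y z -> mor x y -> mor x z;
  compm_idl : forall x y (f : mor x y), compm (idm y) f = f;
  compm_idr : forall x y (f : mor x y), compm f (idm x) = f;
  compmA : forall w x y z (h : mor y z) (g : mor x y) (f : mor w x),
    compm h (compm g f) = compm (compm h g) f
}.
Arguments mor {c} x y.
Arguments idm {c} x.
Arguments compm {c x y z} g f : rename.

Notation "x ⟹ y" := (mor x y) : bicat_scope.
Notation "β ∘ α" := (compm β α) : bicat_scope.

Record iso (C : category) (x y : C) := Iso {
  iso_mor :> x ⟹ y;
  iso_inv : y ⟹ x;
  iso_invK : iso_inv ∘ iso_mor = idm x;
  iso_morK : iso_mor ∘ iso_inv = idm y
}.
Notation "x ≅ y" := (iso x y) : bicat_scope.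

Record functor (C D : category) := Functor {
  fobj :> C -> D;
  fmap : forall x y : C, x ⟹ y -> fobj x ⟹ fobj y;
  fmap_id : forall x : C, fmap (idm x) = idm (fobj x);
  fmap_comp : forall (x y z : C) (g : y ⟹ z) (f : x ⟹ y),
    fmap (g ∘ f) = fmap g ∘ fmap f
}.
Arguments fmap {C D} F {x y} f : rename.

(** * Bicategories and pseudofunctors *)

(* [comp1]/[hcomp] together with [hcomp_id] and [hcomp_comp] form the
   composition functor Hom Y Z * Hom X Y -> Hom X Z. *)
Record bicategory := Bicategory {
  cell0 :> Type;
  Hom : cell0 -> cell0 -> category;
  id1 : forall X, Hom X X;
  comp1 : forall {X Y Z}, Hom Y Z -> Hom X Y -> Hom X Z;
  hcomp : forall {X Y Z} {g g' : Hom Y Z} {f f' : Hom X Y},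
    g ⟹ g' -> f ⟹ f' -> comp1 g f ⟹ comp1 g' f';
  hcomp_id : forall X Y Z (g : Hom Y Z) (f : Hom X Y),
    hcomp (idm g) (idm f) = idm (comp1 g f);
  hcomp_comp : forall X Y Z (g g' g'' : Hom Y Z) (f f' f'' : Hom X Y)
    (β' : g' ⟹ g'') (β : g ⟹ g') (α' : f' ⟹ f'') (α : f ⟹ f'),
    hcomp (β' ∘ β) (α' ∘ α) = hcomp β' α' ∘ hcomp β α;
  assoc : forall {W X Y Z} (h : Hom Y Z) (g : Hom X Y) (f : Hom W X),
    comp1 (comp1 h g) f ≅ comp1 h (comp1 g f);
  lunit : forall {X Y} (f : Hom X Y), comp1 (id1 Y) f ≅ f;
  runit : forall {X Y} (f : Hom X Y), comp1 f (id1 X) ≅ f;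
  assoc_nat : forall W X Y Z (h h' : Hom Y Z) (g g' : Hom X Y) (f f' : Hom W X)
    (γ : h ⟹ h') (β : g ⟹ g') (α : f ⟹ f'),
    assoc h' g' f' ∘ hcomp (hcomp γ β) α = hcomp γ (hcomp β α) ∘ assoc h g f;
  lunit_nat : forall X Y (f f' : Hom X Y) (α : f ⟹ f'),
    lunit f' ∘ hcomp (idm (id1 Y)) α = α ∘ lunit f;
  runit_nat : forall X Y (f f' : Hom X Y) (α : f ⟹ f'),
    runit f' ∘ hcomp α (idm (id1 X)) = α ∘ runit f;
  pentagon : forall V W X Y Z
    (k : Hom Y Z) (h : Hom X Y) (g : Hom W X) (f : Hom V W),
    assoc k h (comp1 g f) ∘ assoc (comp1 k h) g f =
    hcomp (idm k) (assoc h g f) ∘ assoc k (comp1 h g) f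
      ∘ hcomp (assoc k h g) (idm f);
  triangle : forall X Y Z (g : Hom Y Z) (f : Hom X Y),
    hcomp (idm g) (lunit f) ∘ assoc g (id1 Y) f = hcomp (runit g) (idm f)
}.
Arguments Hom {b} X Y : rename.
Arguments id1 {b} X : rename.
Arguments comp1 {b X Y Z} g f : rename.
Arguments hcomp {b X Y Z g g' f f'} β α : rename.
Arguments assoc {b W X Y Z} h g f : rename.
Arguments lunit {b X Y} f : rename.
Arguments runit {b X Y} f : rename.

Notation "g · f" := (comp1 g f) : bicat_scope.
Notation "g ◁ α" := (hcomp (idm g) α) : bicat_scope.
Notation "β ▷ f" := (hcomp β (idm f)) : bicat_scope.

Record pseudofunctor (A E : bicategory) := Pseudofunctor {
  pf_ob :> A -> E;
  pf_hom : forall {X Y : A}, functor (Hom X Y) (Hom (pf_ob X) (pf_ob Y));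
  pf_comp : forall {X Y Z : A} (g : Hom Y Z) (f : Hom X Y),
    pf_hom g · pf_hom f ≅ pf_hom (g · f);
  pf_unit : forall X : A, id1 (pf_ob X) ≅ pf_hom (id1 X);
  pf_comp_nat : forall (X Y Z : A) (g g' : Hom Y Z) (f f' : Hom X Y)
    (β : g ⟹ g') (α : f ⟹ f'),
    pf_comp g' f' ∘ hcomp (fmap pf_hom β) (fmap pf_hom α) =
    fmap pf_hom (hcomp β α) ∘ pf_comp g f;
  pf_assoc : forall (W X Y Z : A) (h : Hom Y Z) (g : Hom X Y) (f : Hom W X),
    fmap pf_hom (assoc h g f) ∘ pf_comp (h · g) f ∘ (pf_comp h g ▷ pf_hom f) =
    pf_comp h (g · f) ∘ (pf_hom h ◁ pf_comp g f)
      ∘ assoc (pf_hom h) (pf_hom g) (pf_hom f);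
  pf_lunit : forall (X Y : A) (f : Hom X Y),
    fmap pf_hom (lunit f) ∘ pf_comp (id1 Y) f ∘ (pf_unit Y ▷ pf_hom f) =
    lunit (pf_hom f);
  pf_runit : forall (X Y : A) (f : Hom X Y),
    fmap pf_hom (runit f) ∘ pf_comp f (id1 X) ∘ (pf_hom f ◁ pf_unit X) =
    runit (pf_hom f)
}.

(** * Adjunctions in a bicategory *)

Record adjunction (E : bicategory) (X Y : E) (l : Hom X Y) (r : Hom Y X) :=
Adjunction {
  adj_unit : id1 X ⟹ r · l;
  adj_counit : l · r ⟹ id1 Y;
  adj_triangle_l :
    lunit l ∘ (adj_counit ▷ l) ∘ iso_inv (assoc l r l) ∘ (l ◁ adj_unit)
      ∘ iso_inv (runit l) = idm l;
  adj_triangle_r :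
    runit r ∘ (r ◁ adj_counit) ∘ assoc r l r ∘ (adj_unit ▷ r)
      ∘ iso_inv (lunit r) = idm r
}.

(** * Relative pseudomonads *)

(* As in the definition of relative pseudomonad, only the action of [J] on
   objects occurs in the data and axioms. *)
Record relative_pseudomonad (A E : bicategory) (J : pseudofunctor A E) :=
RelativePseudomonad {
  rp_ob :> A -> E;
  rp_ext : forall {X Y : A},
    functor (Hom (J X) (rp_ob Y)) (Hom (rp_ob X) (rp_ob Y));
  rp_i : forall X : A, Hom (J X) (rp_ob X);
  rp_mu : forall {X Y Z : A}
    (g : Hom (J Y) (rp_ob Z)) (f : Hom (J X) (rp_ob Y)),
    rp_ext (rp_ext g · f) ≅ rp_ext g · rp_ext f;
  rp_eta : forall {X Y : A} (f : Hom (J X) (rp_ob Y)), f ≅ rp_ext f · rp_i X;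
  rp_theta : forall X : A, rp_ext (rp_i X) ≅ id1 (rp_ob X);
  rp_mu_nat : forall (X Y Z : A)
    (g g' : Hom (J Y) (rp_ob Z)) (f f' : Hom (J X) (rp_ob Y))
    (β : g ⟹ g') (α : f ⟹ f'),
    rp_mu g' f' ∘ fmap rp_ext (hcomp (fmap rp_ext β) α) =
    hcomp (fmap rp_ext β) (fmap rp_ext α) ∘ rp_mu g f;
  rp_eta_nat : forall (X Y : A) (f f' : Hom (J X) (rp_ob Y)) (α : f ⟹ f'),
    rp_eta f' ∘ α = (fmap rp_ext α ▷ rp_i X) ∘ rp_eta f;
  rp_assoc : forall (W X Y Z : A)
    (f : Hom (J W) (rp_ob X)) (g : Hom (J X) (rp_ob Y))
    (h : Hom (J Y) (rp_ob Z)),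
    assoc (rp_ext h) (rp_ext g) (rp_ext f)
      ∘ (rp_mu h g ▷ rp_ext f) ∘ rp_mu (rp_ext h · g) f =
    (rp_ext h ◁ rp_mu g f) ∘ rp_mu h (rp_ext g · f)
      ∘ fmap rp_ext (assoc (rp_ext h) (rp_ext g) f)
      ∘ fmap rp_ext (rp_mu h g ▷ f);
  rp_unit : forall (X Y : A) (f : Hom (J X) (rp_ob Y)),
    (rp_ext f ◁ rp_theta X) ∘ rp_mu f (rp_i X) ∘ fmap rp_ext (rp_eta f) =
    iso_inv (runit (rp_ext f))
}.
Arguments rp_ext {A E J} T {X Y} : rename.
Arguments rp_i {A E J} T X : rename.
Arguments rp_mu {A E J} T {X Y Z} g f : rename.
Arguments rp_eta {A E J} T {X Y} f : rename.
Arguments rp_theta {A E J} T X : rename.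

(** * Pseudoalgebras *)

Record pseudoalgebra (A E : bicategory) (J : pseudofunctor A E)
    (T : relative_pseudomonad J) := Pseudoalgebra {
  carrier :> E;
  pa_ext : forall {X : A}, functor (Hom (J X) carrier) (Hom (T X) carrier);
  pa_hat : forall {X Y : A} (g : Hom (J Y) carrier) (f : Hom (J X) (T Y)),
    pa_ext (pa_ext g · f) ≅ pa_ext g · rp_ext T f;
  pa_tilde : forall {X : A} (f : Hom (J X) carrier), f ≅ pa_ext f · rp_i T X;
  pa_hat_nat : forall (X Y : A)
    (g g' : Hom (J Y) carrier) (f f' : Hom (J X) (T Y))
    (β : g ⟹ g') (α : f ⟹ f'),
    pa_hat g' f' ∘ fmap pa_ext (hcomp (fmap pa_ext β) α) =
    hcomp (fmap pa_ext β) (fmap (rp_ext T) α) ∘ pa_hat g f;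
  pa_tilde_nat : forall (X : A) (f f' : Hom (J X) carrier) (α : f ⟹ f'),
    pa_tilde f' ∘ α = (fmap pa_ext α ▷ rp_i T X) ∘ pa_tilde f;
  pa_assoc : forall (X Y Z : A)
    (f : Hom (J X) (T Y)) (g : Hom (J Y) (T Z)) (h : Hom (J Z) carrier),
    assoc (pa_ext h) (rp_ext T g) (rp_ext T f)
      ∘ (pa_hat h g ▷ rp_ext T f) ∘ pa_hat (pa_ext h · g) f =
    (pa_ext h ◁ rp_mu T g f) ∘ pa_hat h (rp_ext T g · f)
      ∘ fmap pa_ext (assoc (pa_ext h) (rp_ext T g) f)
      ∘ fmap pa_ext (pa_hat h g ▷ f);
  pa_unit : forall (X : A) (f : Hom (J X) carrier),
    (pa_ext f ◁ rp_theta T X) ∘ pa_hat f (rp_i T X) ∘ fmap pa_ext (pa_tilde f) =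
    iso_inv (runit (pa_ext f))
}.
Arguments carrier {A E J T} M : rename.
Arguments pa_ext {A E J T} M {X} : rename.
Arguments pa_hat {A E J T} M {X Y} g f : rename.
Arguments pa_tilde {A E J T} M {X} f : rename.

(** * Lax and colax morphism structures on a 1-cell between carriers *)

Record lax_structure (A E : bicategory) (J : pseudofunctor A E)
    (T : relative_pseudomonad J) (M N : pseudoalgebra T)
    (h : Hom (carrier M) (carrier N)) := LaxStructure {
  lax_cell : forall {X : A} (f : Hom (J X) (carrier M)),
    pa_ext N (h · f) ⟹ h · pa_ext M f;
  lax_nat : forall (X : A) (f f' : Hom (J X) (carrier M)) (α : f ⟹ f'),
    lax_cell f' ∘ fmap (pa_ext N) (h ◁ α) =
    (h ◁ fmap (pa_ext M) α) ∘ lax_cell f;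
  lax_hat : forall (X Y : A)
    (f : Hom (J X) (T Y)) (g : Hom (J Y) (carrier M)),
    (h ◁ pa_hat M g f) ∘ lax_cell (pa_ext M g · f)
      ∘ fmap (pa_ext N) (assoc h (pa_ext M g) f)
      ∘ fmap (pa_ext N) (lax_cell g ▷ f) =
    assoc h (pa_ext M g) (rp_ext T f)
      ∘ (lax_cell g ▷ rp_ext T f) ∘ pa_hat N (h · g) f;
  lax_tilde : forall (X : A) (f : Hom (J X) (carrier M)),
    assoc h (pa_ext M f) (rp_i T X)
      ∘ (lax_cell f ▷ rp_i T X) ∘ pa_tilde N (h · f) =
    h ◁ pa_tilde M f
}.
Arguments lax_structure {A E J T} M N h.

Record colax_structure (A E : bicategory) (J : pseudofunctor A E)
    (T : relative_pseudomonad J) (M N : pseudoalgebra T)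
    (h : Hom (carrier M) (carrier N)) := ColaxStructure {
  colax_cell : forall {X : A} (f : Hom (J X) (carrier M)),
    h · pa_ext M f ⟹ pa_ext N (h · f);
  colax_nat : forall (X : A) (f f' : Hom (J X) (carrier M)) (α : f ⟹ f'),
    colax_cell f' ∘ (h ◁ fmap (pa_ext M) α) =
    fmap (pa_ext N) (h ◁ α) ∘ colax_cell f;
  colax_hat : forall (X Y : A)
    (f : Hom (J X) (T Y)) (g : Hom (J Y) (carrier M)),
    pa_hat N (h · g) f ∘ fmap (pa_ext N) (colax_cell g ▷ f)
      ∘ fmap (pa_ext N) (iso_inv (assoc h (pa_ext M g) f))
      ∘ colax_cell (pa_ext M g · f) =
    (colax_cell g ▷ rp_ext T f) ∘ iso_inv (assoc h (pa_ext M g) (rp_ext T f))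
      ∘ (h ◁ pa_hat M g f);
  colax_tilde : forall (X : A) (f : Hom (J X) (carrier M)),
    (colax_cell f ▷ rp_i T X) ∘ iso_inv (assoc h (pa_ext M f) (rp_i T X))
      ∘ (h ◁ pa_tilde M f) =
    pa_tilde N (h · f)
}.
Arguments colax_structure {A E J T} M N h.

(* Main.v *)
Require Import Defs.
From Stdlib Require Import FunctionalExtensionality ProofIrrelevance.

(** This is doctrinal adjunction: colax and lax structures are each other's
    mates under [l ⊣ r].

    Postcomposition with [l] and with [r] are adjoint functors between the
    hom-categories into the two carriers, so 2-cells [φ : l · x ⟹ y]
    correspond to 2-cells [x ⟹ r · y] ([transpose], [untranspose]).  This
    bijection is natural in [x] and [y], and compatible with precomposition by
    a 1-cell ([transpose_rwhisk]); all coherence isomorphisms of the bicategory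
    are dealt with in establishing these facts.

    A family [σ] of colax cells and a family [ρ] of lax cells are called mates
    when transposition commutes with extension: the transpose of [φ^b ∘ σ_x] is
    [ρ_y ∘ (transpose φ)^a], for every [φ : l · x ⟹ y].  This condition puts the two families on an equal footing.
    Each natural family has exactly one mate ([mates_lax_mate],
    [mates_lax_unique] and their colax counterparts), and any pair of mates is
    natural on both sides.

    It remains to see that [σ] satisfies the colax axioms exactly when [ρ]
    satisfies the lax ones.  Postcompose each side of the colax axiom at [x] with
    a whiskering of [φ^b]: its transpose is the same side of the lax axiom at [y], precomposed
    with a cell obtained from [transpose φ] ([transpose_hat_lhs],
    [transpose_hat_rhs], [transpose_tilde_lhs], [transpose_tilde_rhs]).  Taking
    for [φ] the counit at [y], whose transpose is an identity, the lax axiom at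
    [y] follows from the colax axiom at [r · y].  Taking for [φ] the identity of
    [l · x], the colax axiom at [x] follows from the lax axiom at [l · x], since
    transposition is injective.

    Structures with the same cells are equal by proof irrelevance, so the
    correspondence of cells is a bijection of structures. *)

Set Implicit Arguments.
Unset Strict Implicit.
Unset Printing Implicit Defensive.

(** * Calculus of 2-cells *)

(** Composites associate to the left, so a redex [a ∘ b]
    inside [c ∘ a ∘ b] is not a subterm; rewriting with
    this lemma reaches it. *)
Lemma compm_under (C : category) (w x y z : C) (a : x ⟹ y) (b : w ⟹ x)
    (m : w ⟹ y) (e : a ∘ b = m) (c : y ⟹ z) : c ∘ a ∘ b = c ∘ m.
Proof. by rewrite -compmA e. Qed.

Lemma iso_morKl (C : category) (x y z : C) (i : x ≅ y) (a : y ⟹ z) :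
  a ∘ i ∘ iso_inv i = a.
Proof. by rewrite -compmA iso_morK compm_idr. Qed.

Lemma iso_invKl (C : category) (x y z : C) (i : x ≅ y) (a : x ⟹ z) :
  a ∘ iso_inv i ∘ i = a.
Proof. by rewrite -compmA iso_invK compm_idr. Qed.

Lemma iso_epi (C : category) (x y z : C) (i : x ≅ y) (a b : y ⟹ z) :
  a ∘ i = b ∘ i -> a = b.
Proof. by move=> e; rewrite -(iso_morKl i a) e iso_morKl. Qed.

Lemma iso_mono (C : category) (x y z : C) (i : y ≅ z) (a b : x ⟹ y) :
  i ∘ a = i ∘ b -> a = b.
Proof.
by move=> e; rewrite -(compm_idl a) -(compm_idl b) -(iso_invK i) -!compmA e.
Qed.

Lemma iso_inv_square (C : category) (x x' y y' : C) (i : x ≅ y) (j : x' ≅ y')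
    (a : x ⟹ x') (b : y ⟹ y') :
  j ∘ a = b ∘ i -> iso_inv j ∘ b = a ∘ iso_inv i.
Proof.
by move=> e; apply: (@iso_epi _ _ _ _ i); rewrite -compmA -e compmA iso_invK
  compm_idl iso_invKl.
Qed.

Lemma lwhisk_comp (E : bicategory) (X Y Z : E) (g : Hom Y Z)
    (f f' f'' : Hom X Y) (β : f' ⟹ f'') (α : f ⟹ f') :
  g ◁ (β ∘ α) = (g ◁ β) ∘ (g ◁ α).
Proof. by rewrite -hcomp_comp compm_idl. Qed.

Lemma rwhisk_comp (E : bicategory) (X Y Z : E) (f : Hom X Y)
    (g g' g'' : Hom Y Z) (β : g' ⟹ g'') (α : g ⟹ g') :
  (β ∘ α) ▷ f = (β ▷ f) ∘ (α ▷ f).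
Proof. by rewrite -hcomp_comp compm_idl. Qed.

Lemma interchange (E : bicategory) (X Y Z : E) (g g' : Hom Y Z)
    (f f' : Hom X Y) (β : g ⟹ g') (α : f ⟹ f') :
  (β ▷ f') ∘ (g ◁ α) = (g' ◁ α) ∘ (β ▷ f).
Proof. by rewrite -!hcomp_comp !compm_idl !compm_idr. Qed.

Lemma assoc_nat_l (E : bicategory) (W X Y Z : E) (h h' : Hom Y Z)
    (γ : h ⟹ h') (g : Hom X Y) (f : Hom W X) :
  assoc h' g f ∘ ((γ ▷ g) ▷ f) = (γ ▷ (g · f)) ∘ assoc h g f.
Proof. by rewrite assoc_nat hcomp_id. Qed.

Lemma assoc_nat_m (E : bicategory) (W X Y Z : E) (h : Hom Y Z)
    (g g' : Hom X Y) (β : g ⟹ g') (f : Hom W X) :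
  assoc h g' f ∘ ((h ◁ β) ▷ f) = (h ◁ (β ▷ f)) ∘ assoc h g f.
Proof. exact: assoc_nat. Qed.

Lemma assoc_nat_r (E : bicategory) (W X Y Z : E) (h : Hom Y Z) (g : Hom X Y)
    (f f' : Hom W X) (α : f ⟹ f') :
  assoc h g f' ∘ ((h · g) ◁ α) = (h ◁ (g ◁ α)) ∘ assoc h g f.
Proof. by rewrite -hcomp_id assoc_nat. Qed.

Lemma lwhisk_id_inj (E : bicategory) (X Y : E) (f f' : Hom X Y)
    (α β : f ⟹ f') : id1 Y ◁ α = id1 Y ◁ β -> α = β.
Proof. by move=> e; apply: (@iso_epi _ _ _ _ (lunit f)); rewrite -!lunit_nat e. Qed.

(** Kelly's redundancy argument: the outer faces of the pentagon for
    [id1 · id1 · x · f] are triangles, so the remaining one commutes after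
    whiskering by [id1], and whiskering by [id1] is faithful. *)
Lemma lunit_comp (E : bicategory) (X Y Z : E) (x : Hom Y Z) (f : Hom X Y) :
  lunit (x · f) ∘ assoc (id1 Z) x f = lunit x ▷ f.
Proof.
apply: lwhisk_id_inj; apply: (@iso_epi _ _ _ _ (assoc _ _ _)).
have assocK : (assoc (id1 Z) (id1 Z) x ▷ f) ∘
    (iso_inv (assoc (id1 Z) (id1 Z) x) ▷ f) = idm _.
  by rewrite -rwhisk_comp iso_morK hcomp_id.
rewrite -[LHS]compm_idr -[RHS]compm_idr -assocK !compmA; congr (_ ∘ _).
rewrite lwhisk_comp -!compmA (compmA (_ ◁ _) (assoc _ _ _)) -pentagon.
by rewrite compmA triangle -assoc_nat_l -triangle rwhisk_comp !compmA assoc_nat_m.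
Qed.

(** * Transposition along an adjunction *)

Definition whisker_unit (E : bicategory) (X Y Z : E) (l : Hom X Y)
    (r : Hom Y X) (adj : adjunction l r) (x : Hom Z X) : x ⟹ r · (l · x) :=
  assoc r l x ∘ (adj_unit adj ▷ x) ∘ iso_inv (lunit x).

Definition whisker_counit (E : bicategory) (X Y Z : E) (l : Hom X Y)
    (r : Hom Y X) (adj : adjunction l r) (y : Hom Z Y) : l · (r · y) ⟹ y :=
  lunit y ∘ (adj_counit adj ▷ y) ∘ iso_inv (assoc l r y).

Definition transpose (E : bicategory) (X Y Z : E) (l : Hom X Y)
    (r : Hom Y X) (adj : adjunction l r) (x : Hom Z X) (y : Hom Z Y)
    (φ : l · x ⟹ y) : x ⟹ r · y :=
  (r ◁ φ) ∘ whisker_unit adj x.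

Definition untranspose (E : bicategory) (X Y Z : E) (l : Hom X Y)
    (r : Hom Y X) (adj : adjunction l r) (x : Hom Z X) (y : Hom Z Y)
    (ψ : x ⟹ r · y) : l · x ⟹ y :=
  whisker_counit adj y ∘ (l ◁ ψ).

Section Transposition.
Context (E : bicategory) (X Y : E) (l : Hom X Y) (r : Hom Y X)
  (adj : adjunction l r).

Lemma whisker_unit_nat (Z : E) (x x' : Hom Z X) (α : x ⟹ x') :
  whisker_unit adj x' ∘ α = (r ◁ (l ◁ α)) ∘ whisker_unit adj x.
Proof.
rewrite /whisker_unit !compmA -assoc_nat_r (compm_under (esym (interchange _ _))).
by rewrite compmA -!compmA (iso_inv_square (lunit_nat α)).
Qed.

Lemma whisker_counit_nat (Z : E) (y y' : Hom Z Y) (β : y ⟹ y') :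
  whisker_counit adj y' ∘ (l ◁ (r ◁ β)) = β ∘ whisker_counit adj y.
Proof.
rewrite /whisker_counit !compmA -lunit_nat.
rewrite (compm_under (iso_inv_square (assoc_nat_r l r β))) compmA.
by rewrite (compm_under (interchange _ _)) compmA.
Qed.

(** By the pentagon and the unit coherences, the composite is the triangle of
    the adjunction at [l], whiskered by [x]. *)
Lemma whisker_triangle_l (Z : E) (x : Hom Z X) :
  whisker_counit adj (l · x) ∘ (l ◁ whisker_unit adj x) = idm (l · x).
Proof.
rewrite /whisker_counit /whisker_unit !lwhisk_comp !compmA.
have pent : iso_inv (assoc l r (l · x)) ∘ (l ◁ assoc r l x) =
    assoc (l · r) l x ∘ (iso_inv (assoc l r l) ▷ x) ∘ iso_inv (assoc l (r · l) x).
  apply: (@iso_epi _ _ _ _ (assoc _ _ _)); rewrite iso_invKl.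
  have := pentagon l r l x => /(congr1 (fun m => iso_inv (assoc l r (l · x))
    ∘ (m ∘ (iso_inv (assoc l r l) ▷ x)))).
  by rewrite -!compmA -rwhisk_comp iso_morK hcomp_id compm_idr
    (compmA _ (assoc l r (l · x))) iso_invK compm_idl.
have tri : iso_inv (assoc l (id1 X) x) ∘ (l ◁ iso_inv (lunit x)) =
    iso_inv (runit l) ▷ x.
  have e : l ◁ iso_inv (lunit x) = assoc l (id1 X) x ∘ (iso_inv (runit l) ▷ x).
    have := triangle l x => /(congr1 (fun m => (l ◁ iso_inv (lunit x))
      ∘ (m ∘ (iso_inv (runit l) ▷ x)))).
    by rewrite -rwhisk_comp iso_morK hcomp_id compm_idr => <-;
      rewrite !compmA -lwhisk_comp iso_invK hcomp_id compm_idl.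
  by rewrite e compmA iso_invK compm_idl.
rewrite (compm_under pent) !compmA (compm_under (esym (assoc_nat_l _ _ _))).
rewrite !compmA lunit_comp (compm_under (iso_inv_square (assoc_nat_m _ _ _))).
by rewrite !compmA (compm_under tri) -!rwhisk_comp adj_triangle_l hcomp_id.
Qed.

(** As for the other triangle, now with the one at [r]. *)
Lemma whisker_triangle_r (Z : E) (y : Hom Z Y) :
  (r ◁ whisker_counit adj y) ∘ whisker_unit adj (r · y) = idm (r · y).
Proof.
rewrite /whisker_counit /whisker_unit !lwhisk_comp !compmA.
have pent : (r ◁ iso_inv (assoc l r y)) ∘ assoc r l (r · y) =
    assoc r (l · r) y ∘ (assoc r l r ▷ y) ∘ iso_inv (assoc (r · l) r y).
  apply: (@iso_epi _ _ _ _ (assoc _ _ _)); rewrite iso_invKl -compmA pentagon.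
  by rewrite !compmA -lwhisk_comp iso_invK hcomp_id compm_idl.
have lun : iso_inv (assoc (id1 X) r y) ∘ iso_inv (lunit (r · y)) =
    iso_inv (lunit r) ▷ y.
  apply: (@iso_mono _ _ _ _ (assoc _ _ _)); rewrite compmA iso_morK compm_idl.
  apply: (@iso_mono _ _ _ _ (lunit _)); rewrite iso_morK compmA lunit_comp.
  by rewrite -rwhisk_comp iso_morK hcomp_id.
rewrite (compm_under pent) !compmA (compm_under (esym (assoc_nat_m _ _ _))).
rewrite !compmA triangle (compm_under (iso_inv_square (assoc_nat_l _ _ _))).
by rewrite !compmA (compm_under lun) -!rwhisk_comp adj_triangle_r hcomp_id.
Qed.

(** The pentagon moves the associators past each other, and [lunit_comp] treats
    the left unitor. *)
Lemma whisker_unit_comp (W Z : E) (x : Hom Z X) (f : Hom W Z) :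
  (r ◁ assoc l x f) ∘ assoc r (l · x) f ∘ (whisker_unit adj x ▷ f) =
  whisker_unit adj (x · f).
Proof.
rewrite /whisker_unit !rwhisk_comp !compmA -pentagon.
rewrite (compm_under (assoc_nat_l _ _ _)) !compmA -!compmA; congr (_ ∘ (_ ∘ _)).
apply: (@iso_mono _ _ _ _ (lunit _)); rewrite iso_morK compmA lunit_comp.
by rewrite -rwhisk_comp iso_morK hcomp_id.
Qed.

Lemma transposeK (Z : E) (x : Hom Z X) (y : Hom Z Y) :
  cancel (@transpose _ _ _ _ _ _ adj x y) (@untranspose _ _ _ _ _ _ adj x y).
Proof.
move=> φ; rewrite /untranspose /transpose lwhisk_comp compmA whisker_counit_nat.
by rewrite -compmA whisker_triangle_l compm_idr.
Qed.

Lemma transpose_inj (Z : E) (x : Hom Z X) (y : Hom Z Y) (φ φ' : l · x ⟹ y) :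
  transpose adj φ = transpose adj φ' -> φ = φ'.
Proof. by move=> e; rewrite -(transposeK φ) e transposeK. Qed.

Lemma untransposeK (Z : E) (x : Hom Z X) (y : Hom Z Y) :
  cancel (@untranspose _ _ _ _ _ _ adj x y) (@transpose _ _ _ _ _ _ adj x y).
Proof.
move=> ψ; rewrite /untranspose /transpose lwhisk_comp -compmA.
by rewrite -whisker_unit_nat compmA whisker_triangle_r compm_idl.
Qed.

Lemma transpose_post (Z : E) (x : Hom Z X) (y y' : Hom Z Y) (β : y ⟹ y')
    (φ : l · x ⟹ y) :
  transpose adj (β ∘ φ) = (r ◁ β) ∘ transpose adj φ.
Proof. by rewrite /transpose lwhisk_comp compmA. Qed.

Lemma transpose_pre (Z : E) (x x' : Hom Z X) (y : Hom Z Y) (α : x ⟹ x')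
    (φ : l · x' ⟹ y) :
  transpose adj (φ ∘ (l ◁ α)) = transpose adj φ ∘ α.
Proof. by rewrite /transpose lwhisk_comp -!(compmA (r ◁ φ)) whisker_unit_nat. Qed.

(** The step that relates an axiom for [l], where the associator occurs inverted,
    to one for [r], where it does not. *)
Lemma transpose_rwhisk (W Z : E) (x : Hom Z X) (y : Hom Z Y) (f : Hom W Z)
    (φ : l · x ⟹ y) :
  transpose adj ((φ ▷ f) ∘ iso_inv (assoc l x f)) =
  assoc r y f ∘ (transpose adj φ ▷ f).
Proof.
rewrite /transpose lwhisk_comp -whisker_unit_comp rwhisk_comp !compmA.
rewrite assoc_nat_m -(compmA _ _ (r ◁ assoc l x f)) -lwhisk_comp iso_invK.
by rewrite hcomp_id compm_idr.
Qed.

End Transposition.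

(** * Mates *)

(** Allowing every [φ : l · x ⟹ y] makes the condition symmetric between [σ]
    and [ρ], and includes their naturality.  With [φ] the identity of [l · x] it
    determines [σ] from [ρ]; with [φ] the counit at [y] it determines [ρ] from
    [σ]. *)
Definition mates (A E : bicategory) (J : pseudofunctor A E)
    (T : relative_pseudomonad J) (M N : pseudoalgebra T)
    (l : Hom (carrier M) (carrier N)) (r : Hom (carrier N) (carrier M))
    (adj : adjunction l r)
    (σ : forall (X : A) (x : Hom (J X) M), l · pa_ext M x ⟹ pa_ext N (l · x))
    (ρ : forall (X : A) (y : Hom (J X) N), pa_ext M (r · y) ⟹ r · pa_ext N y) :=
  forall (X : A) (x : Hom (J X) M) (y : Hom (J X) N) (φ : l · x ⟹ y),
    transpose adj (fmap (pa_ext N) φ ∘ σ X x) =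
    ρ X y ∘ fmap (pa_ext M) (transpose adj φ).

Section Mates.
Context (A E : bicategory) (J : pseudofunctor A E)
  (T : relative_pseudomonad J) (M N : pseudoalgebra T)
  (l : Hom (carrier M) (carrier N)) (r : Hom (carrier N) (carrier M))
  (adj : adjunction l r).

Let colax_cells :=
  forall (X : A) (x : Hom (J X) M), l · pa_ext M x ⟹ pa_ext N (l · x).
Let lax_cells :=
  forall (X : A) (y : Hom (J X) N), pa_ext M (r · y) ⟹ r · pa_ext N y.

(** The transposed identity is the counit at [y]. *)
Definition lax_mate (σ : colax_cells) : lax_cells := fun X y =>
  transpose adj (fmap (pa_ext N) (untranspose adj (idm (r · y))) ∘ σ X (r · y)).

(** The transposed identity is the unit at [x]. *)
Definition colax_mate (ρ : lax_cells) : colax_cells := fun X x =>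
  untranspose adj (ρ X (l · x) ∘ fmap (pa_ext M) (transpose adj (idm (l · x)))).

(** Any [φ] is the counit at [y] after [l ◁ transpose φ]; naturality of [σ]
    moves the second factor across [σ], and then out of the transposition. *)
Lemma mates_lax_mate (σ : colax_cells) :
  (forall X (x x' : Hom (J X) M) (α : x ⟹ x'),
    σ X x' ∘ (l ◁ fmap (pa_ext M) α) = fmap (pa_ext N) (l ◁ α) ∘ σ X x) ->
  mates adj σ (lax_mate σ).
Proof.
move=> nat X x y φ; rewrite /lax_mate -transpose_pre -compmA nat compmA.
rewrite -fmap_comp; congr (transpose _ (fmap _ _ ∘ _)).
apply: (@transpose_inj _ _ _ _ _ adj).
by rewrite transpose_pre untransposeK compm_idl.
Qed.

(** Dually, [transpose φ] is [r ◁ φ] after the unit at [x]. *)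
Lemma mates_colax_mate (ρ : lax_cells) :
  (forall X (y y' : Hom (J X) N) (β : y ⟹ y'),
    ρ X y' ∘ fmap (pa_ext M) (r ◁ β) = (r ◁ fmap (pa_ext N) β) ∘ ρ X y) ->
  mates adj (colax_mate ρ) ρ.
Proof.
move=> nat X x y φ; rewrite /colax_mate transpose_post untransposeK compmA -nat.
by rewrite -compmA -fmap_comp -transpose_post compm_idr.
Qed.

Lemma mates_lax_unique (σ : colax_cells) (ρ : lax_cells) :
  mates adj σ ρ -> lax_mate σ = ρ.
Proof.
move=> m; apply: functional_extensionality_dep => X.
apply: functional_extensionality_dep => y.
by rewrite /lax_mate m untransposeK fmap_id compm_idr.
Qed.

Lemma mates_colax_unique (σ : colax_cells) (ρ : lax_cells) :
  mates adj σ ρ -> colax_mate ρ = σ.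
Proof.
move=> m; apply: functional_extensionality_dep => X.
apply: functional_extensionality_dep => x.
by rewrite /colax_mate -m transposeK fmap_id compm_idl.
Qed.

Section MatePair.
Context (σ : colax_cells) (ρ : lax_cells) (mate : mates adj (@σ) (@ρ)).

Lemma mates_colax_nat (X : A) (x x' : Hom (J X) M) (α : x ⟹ x') :
  σ x' ∘ (l ◁ fmap (pa_ext M) α) = fmap (pa_ext N) (l ◁ α) ∘ σ x.
Proof.
apply: (@transpose_inj _ _ _ _ _ adj); rewrite transpose_pre mate.
rewrite -[σ x']compm_idl -fmap_id mate -compmA -fmap_comp -transpose_pre.
by rewrite compm_idl.
Qed.

Lemma mates_lax_nat (X : A) (y y' : Hom (J X) N) (β : y ⟹ y') :
  ρ y' ∘ fmap (pa_ext M) (r ◁ β) = (r ◁ fmap (pa_ext N) β) ∘ ρ y.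
Proof.
rewrite -[ρ y]compm_idr -fmap_id -[idm (r · y)](untransposeK adj) -mate.
rewrite -transpose_post compmA -fmap_comp mate transpose_post untransposeK.
by rewrite compm_idr.
Qed.

Definition colax_hat_lhs X Y (f : Hom (J X) (T Y)) (x : Hom (J Y) M) :=
  pa_hat N (l · x) f ∘ fmap (pa_ext N) (σ x ▷ f)
    ∘ fmap (pa_ext N) (iso_inv (assoc l (pa_ext M x) f))
    ∘ σ (pa_ext M x · f).
Definition colax_hat_rhs X Y (f : Hom (J X) (T Y)) (x : Hom (J Y) M) :=
  (σ x ▷ rp_ext T f) ∘ iso_inv (assoc l (pa_ext M x) (rp_ext T f))
    ∘ (l ◁ pa_hat M x f).
Definition lax_hat_lhs X Y (f : Hom (J X) (T Y)) (y : Hom (J Y) N) :=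
  (r ◁ pa_hat N y f) ∘ ρ (pa_ext N y · f)
    ∘ fmap (pa_ext M) (assoc r (pa_ext N y) f)
    ∘ fmap (pa_ext M) (ρ y ▷ f).
Definition lax_hat_rhs X Y (f : Hom (J X) (T Y)) (y : Hom (J Y) N) :=
  assoc r (pa_ext N y) (rp_ext T f)
    ∘ (ρ y ▷ rp_ext T f) ∘ pa_hat M (r · y) f.

(** Naturality of [pa_hat N] brings [φ] next to [σ] under the extension.  The
    mate condition then applies twice: to the outer [σ], and to the inner
    composite of [φ] and [σ] reached by [transpose_rwhisk]. *)
Lemma transpose_hat_lhs X Y (f : Hom (J X) (T Y)) (x : Hom (J Y) M)
    (y : Hom (J Y) N) (φ : l · x ⟹ y) :
  transpose adj ((fmap (pa_ext N) φ ▷ rp_ext T f) ∘ colax_hat_lhs f x) =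
  lax_hat_lhs f y ∘ fmap (pa_ext M) (fmap (pa_ext M) (transpose adj φ) ▷ f).
Proof.
rewrite /colax_hat_lhs /lax_hat_lhs !compmA.
have := pa_hat_nat φ (idm f); rewrite fmap_id => <-.
rewrite -!compmA (compmA (fmap _ (_ ▷ f))) -fmap_comp -rwhisk_comp.
rewrite (compmA (fmap _ (_ ▷ f))) -fmap_comp transpose_post mate.
rewrite transpose_rwhisk mate -!fmap_comp.
by rewrite -rwhisk_comp.
Qed.

(** Here the mate condition applies once, and naturality of [pa_hat M] moves
    [transpose φ] to the far right. *)
Lemma transpose_hat_rhs X Y (f : Hom (J X) (T Y)) (x : Hom (J Y) M)
    (y : Hom (J Y) N) (φ : l · x ⟹ y) :
  transpose adj ((fmap (pa_ext N) φ ▷ rp_ext T f) ∘ colax_hat_rhs f x) =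
  lax_hat_rhs f y ∘ fmap (pa_ext M) (fmap (pa_ext M) (transpose adj φ) ▷ f).
Proof.
rewrite /colax_hat_rhs /lax_hat_rhs !compmA -rwhisk_comp transpose_pre.
rewrite transpose_rwhisk mate rwhisk_comp -!compmA.
by have := pa_hat_nat (transpose adj φ) (idm f); rewrite fmap_id => ->.
Qed.

Definition colax_tilde_lhs X (x : Hom (J X) M) :=
  (σ x ▷ rp_i T X) ∘ iso_inv (assoc l (pa_ext M x) (rp_i T X))
    ∘ (l ◁ pa_tilde M x).
Definition lax_tilde_lhs X (y : Hom (J X) N) :=
  assoc r (pa_ext N y) (rp_i T X)
    ∘ (ρ y ▷ rp_i T X) ∘ pa_tilde M (r · y).

Lemma transpose_tilde_lhs X (x : Hom (J X) M) (y : Hom (J X) N)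
    (φ : l · x ⟹ y) :
  transpose adj ((fmap (pa_ext N) φ ▷ rp_i T X) ∘ colax_tilde_lhs x) =
  lax_tilde_lhs y ∘ transpose adj φ.
Proof.
rewrite /colax_tilde_lhs /lax_tilde_lhs 2!compmA -rwhisk_comp transpose_pre.
rewrite transpose_rwhisk mate rwhisk_comp compmA.
by rewrite (compm_under (esym (pa_tilde_nat _))) compmA.
Qed.

Lemma transpose_tilde_rhs X (x : Hom (J X) M) (y : Hom (J X) N)
    (φ : l · x ⟹ y) :
  transpose adj ((fmap (pa_ext N) φ ▷ rp_i T X) ∘ pa_tilde N (l · x)) =
  (r ◁ pa_tilde N y) ∘ transpose adj φ.
Proof. by rewrite -pa_tilde_nat transpose_post. Qed.

(** Transposing the colax axiom at [r · y] along the counit at [y], whose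
    transpose is an identity. *)
Lemma mates_lax_hat X Y (f : Hom (J X) (T Y)) (y : Hom (J Y) N) :
  colax_hat_lhs f (r · y) = colax_hat_rhs f (r · y) ->
  lax_hat_lhs f y = lax_hat_rhs f y.
Proof.
move=> e; rewrite -[LHS]compm_idr -[RHS]compm_idr.
rewrite -fmap_id -hcomp_id -fmap_id -[idm (r · y)](untransposeK adj).
by rewrite -transpose_hat_lhs e transpose_hat_rhs.
Qed.

(** The colax axiom at [x] and the lax axiom at [l · x] are transposes along the
    identity of [l · x], up to a common precomposite. *)
Lemma mates_colax_hat X Y (f : Hom (J X) (T Y)) (x : Hom (J Y) M) :
  lax_hat_lhs f (l · x) = lax_hat_rhs f (l · x) ->
  colax_hat_lhs f x = colax_hat_rhs f x.
Proof.
move=> e; apply: (@transpose_inj _ _ _ _ _ adj).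
rewrite -[colax_hat_lhs f x]compm_idl -[colax_hat_rhs f x]compm_idl.
by rewrite -hcomp_id -fmap_id transpose_hat_lhs e transpose_hat_rhs.
Qed.

Lemma mates_lax_tilde X (y : Hom (J X) N) :
  colax_tilde_lhs (r · y) = pa_tilde N (l · (r · y)) ->
  lax_tilde_lhs y = r ◁ pa_tilde N y.
Proof.
move=> e; rewrite -[LHS]compm_idr -[RHS]compm_idr.
rewrite -[idm (r · y)](untransposeK adj).
by rewrite -transpose_tilde_lhs e transpose_tilde_rhs.
Qed.

Lemma mates_colax_tilde X (x : Hom (J X) M) :
  lax_tilde_lhs (l · x) = r ◁ pa_tilde N (l · x) ->
  colax_tilde_lhs x = pa_tilde N (l · x).
Proof.
move=> e; apply: (@transpose_inj _ _ _ _ _ adj).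
rewrite -[colax_tilde_lhs x]compm_idl -[iso_mor (pa_tilde N _)]compm_idl.
by rewrite -hcomp_id -fmap_id transpose_tilde_lhs e transpose_tilde_rhs.
Qed.

End MatePair.
End Mates.

(** * The correspondence of structures *)

Lemma lax_structure_eq (A E : bicategory) (J : pseudofunctor A E)
    (T : relative_pseudomonad J) (M N : pseudoalgebra T)
    (h : Hom (carrier M) (carrier N)) (s t : lax_structure M N h) :
  @lax_cell _ _ _ _ _ _ _ s = @lax_cell _ _ _ _ _ _ _ t -> s = t.
Proof.
case: s t => [c n a u] [c' n' a' u'] /= e; case: _ / e n' a' u' => n' a' u'.
by rewrite (proof_irrelevance _ n n') (proof_irrelevance _ a a')
  (proof_irrelevance _ u u').
Qed.

Lemma colax_structure_eq (A E : bicategory) (J : pseudofunctor A E)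
    (T : relative_pseudomonad J) (M N : pseudoalgebra T)
    (h : Hom (carrier M) (carrier N)) (s t : colax_structure M N h) :
  @colax_cell _ _ _ _ _ _ _ s = @colax_cell _ _ _ _ _ _ _ t -> s = t.
Proof.
case: s t => [c n a u] [c' n' a' u'] /= e; case: _ / e n' a' u' => n' a' u'.
by rewrite (proof_irrelevance _ n n') (proof_irrelevance _ a a')
  (proof_irrelevance _ u u').
Qed.

Definition lax_of_colax (A E : bicategory) (J : pseudofunctor A E)
    (T : relative_pseudomonad J) (M N : pseudoalgebra T)
    (l : Hom (carrier M) (carrier N)) (r : Hom (carrier N) (carrier M))
    (adj : adjunction l r) (s : colax_structure M N l) : lax_structure N M r :=
  let m := mates_lax_mate adj (colax_nat s) in
  LaxStructure (mates_lax_nat m)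
    (fun X Y f g => mates_lax_hat m (colax_hat s f (r · g)))
    (fun X f => mates_lax_tilde m (colax_tilde s (r · f))).

Definition colax_of_lax (A E : bicategory) (J : pseudofunctor A E)
    (T : relative_pseudomonad J) (M N : pseudoalgebra T)
    (l : Hom (carrier M) (carrier N)) (r : Hom (carrier N) (carrier M))
    (adj : adjunction l r) (s : lax_structure N M r) : colax_structure M N l :=
  let m := mates_colax_mate adj (lax_nat s) in
  ColaxStructure (mates_colax_nat m)
    (fun X Y f g => mates_colax_hat m (lax_hat s f (l · g)))
    (fun X f => mates_colax_tilde m (lax_tilde s (l · f))).

Theorem theorem4p1 (A E : bicategory) (J : pseudofunctor A E)
    (T : relative_pseudomonad J) (M N : pseudoalgebra T)
    (l : Hom (carrier M) (carrier N)) (r : Hom (carrier N) (carrier M))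
    (adj : adjunction l r) :
  exists F : colax_structure M N l -> lax_structure N M r, bijective F.
Proof.
exists (lax_of_colax adj); exists (colax_of_lax adj) => s.
  apply: colax_structure_eq; apply: mates_colax_unique.
  exact: mates_lax_mate (colax_nat s).
apply: lax_structure_eq; apply: mates_lax_unique.
exact: mates_colax_mate (lax_nat s).
Qed.
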